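(* Let $A,w,Q,\sigma,\beta,v,D,h,a$ and $v^{(i)},\beta^{(i)},\mathcal{M}^{(i)},F_{u^{(i)}}(\Lambda)$ be as in the context. Suppose that for each $i=0,1,\dots,a-1$ $$w(\beta^{(i)})=\max\{w(u^{(i)})\mid u^{(i)}\in\mathcal{M}^{(i)}\}.$$ Then for each $i=0,1,\dots,a-1$ and all $u^{(i)}\in\mathcal{M}^{(i)}$, the series $F_{u^{(i)}}(\Lambda)$ has $p$-integral coefficients for all primes $p\equiv h\pmod{D}$.
   Context: For $z\in\mathbb{C}$, $l\in\mathbb{Z}$ put $[z]_0=1$; $[z]_l=\frac{1}{(z+1)(z+2)\cdots(z+l)}$ if $l>0$ and $z\notin\{-1,\dots,-l\}$; $[z]_l=z(z-1)\cdots(z+l+1)$ if $l<0$. For $N$-tuples, $[z]_l=\prod_{j=1}^N[z_j]_{l_j}$. Let $A=\{\mathbf{a}_1,\dots,\mathbf{a}_N\}\subset\mathbb{Z}^n$ lie on a hyperplane $w(u)=1$, where $w(u)=\sum_{i=1}^n w_iu_i$ with $w_i\in\mathbb{Q}$. Let $\mathbb{Z}A$ be the abelian group generated by $A$, $\mathbb{Q}A$ the rational vector space generated by $A$, and $C(A)\subseteq\mathbb{R}^n$ the real cone generated by $A$. Let $Q\in\mathbb{Q}A$. For a closed face $\sigma$ of $-C(A)$ (possibly $-C(A)$ itself), $\sigma^\circ$ is its relative interior. Fix $\sigma$ such that $\mathcal{M}:=(Q+\mathbb{Z}A)\cap\sigma^\circ$ is nonempty. Fix $\beta\in\mathcal{M}$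 with $w(\beta)=\max\{w(u)\mid u\in\mathcal{M}\}$ and write $\beta=\sum_{j=1}^N v_j\mathbf{a}_j$ with $v_j\in\mathbb{Q}_{\le 0}$; one then has $-1\le v_j\le 0$ for all $j$. Put $v=(v_1,\dots,v_N)$. Let $D$ be a positive integer with $Dv_j\in\mathbb{Z}$ for all $j$ and let $h$ be a positive integer with $(h,D)=1$. For each rational $y\in[-1,0]$ with $Dy\in\mathbb{Z}$ there is a unique rational $y'\in[-1,0]$ with $Dy'\in\mathbb{Z}$ and $hy-y'\in\{0,-1,\dots,-(h-1)\}$. Let $v_j^{(0)}=v_j$, $v_j^{(i)}=(v_j^{(i-1)})'$, $v^{(i)}=(v_1^{(i)},\dots,v_N^{(i)})$, and let $a$ be a positive integer such that $v_j^{(a)}=v_j$ for all $j$. (One has $v_j^{(i)}=-1$ iff $v_j=-1$, and $v_j^{(i)}=0$ iff $v_j=0$.) Put $\beta^{(i)}=\sum_{j=1}^N v_j^{(i)}\mathbf{a}_j$ and $\mathcal{M}^{(i)}=(h^iQ+\mathbb{Z}A)\cap\sigma^\circ$. Let $E=\{l\in\mathbb{Z}^N\mid l_j\le 0\text{ if }v_j=-1,\ l_j\ge 0\text{ if }v_j=0\}$. For $u^{(i)}\in h^iQ+\mathbb{Z}A$ let $E(u^{(i)})=\{l\in E\mid\sum_{j=1}^N(v_j^{(i)}+l_j)\mathbf{a}_j=u^{(i)}\}$ and define the formal series $$F_{u^{(i)}}(\Lambda_1,\dots,\Lambda_N)=\sum_{l\in E(u^{(i)})}[v^{(i)}]_l\,\Lambda^{v^{(i)}+l},\qquad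 \Lambda^{v^{(i)}+l}=\prod_{j=1}^N\Lambda_j^{v^{(i)}_j+l_j}.$$ Its coefficients are the rational numbers $[v^{(i)}]_l$. *)

(* Defs.v *)
From HB Require Import structures.
From mathcomp Require Import all_boot all_order all_algebra.
From mathcomp Require Import all_classical reals topology normedtype.

Set Implicit Arguments.
Unset Strict Implicit.
Unset Printing Implicit Defensive.

Import Order.TTheory GRing.Theory Num.Theory.
Import numFieldNormedType.Exports.

Local Open Scope classical_set_scope.
Local Open Scope ring_scope.

(* A configuration a_1, ..., a_N in Z^n is the matrix A : 'M[int]_(N, n) whose
   j-th row is a_j, so that \sum_j c_j a_j is the product c *m A, for c a row
   vector with entries in Z, Q or R. *)

Section Bracket.
Variable F : fieldType.

(* For l = m > 0 and z in {-1, ..., -m}, where [z]_l is usually left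
   undefined, the convention 0^-1 = 0 gives the value 0. *)
Definition bracket (z : F) (l : int) : F :=
  match l with
  | Posz m => (\prod_(1 <= k < m.+1) (z + k%:R))^-1
  | Negz m => \prod_(0 <= k < m.+1) (z - k%:R)   (* l = - (m + 1) *)
  end.

Definition mbracket N (z : 'rV[F]_N) (l : 'rV[int]_N) : F :=
  \prod_(j < N) bracket (z 0 j) (l 0 j).

End Bracket.

Section RealCones.
Variables (R : realType) (n : nat).
Implicit Types (C S T : set 'rV[R]_n).

Definition real_cone N (A : 'M[int]_(N, n)) : set 'rV[R]_n :=
  [set x | exists2 c : 'rV[R]_N,
     (forall j, 0 <= c 0 j) & x = c *m map_mx intr A].

(* The linear form is allowed to vanish on C, in which case T = C. *)
Definition closed_face C T : Prop :=
  exists2 f : 'cV[R]_n,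
    (forall x, C x -> 0 <= (x *m f) 0 0) &
    T = C `&` [set x | (x *m f) 0 0 = 0].

Definition affine_hull S : set 'rV[R]_n :=
  [set x | exists k (c : 'rV[R]_k) (P : 'M[R]_(k, n)),
     [/\ forall i, S (row i P), \sum_(i < k) c 0 i = 1 & x = c *m P]].

Definition relint S : set 'rV[R]_n :=
  [set x | S x /\ within (affine_hull S) (nbhs x) S].

End RealCones.

Definition linform n (w : 'cV[rat]_n) (u : 'rV[rat]_n) : rat := (u *m w) 0 0.

Definition is_max (S : set rat) (x : rat) : Prop := S x /\ ubound S x.

(* The coset Q + ZA. *)
Definition coset_ZA n N (A : 'M[int]_(N, n)) (Q : 'rV[rat]_n) :
    set 'rV[rat]_n :=
  [set u | exists m : 'rV[int]_N, u = Q + map_mx intr (m *m A)].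

Definition coset_relint (R : realType) n N (A : 'M[int]_(N, n))
    (sigma : set 'rV[R]_n) (Q : 'rV[rat]_n) : set 'rV[rat]_n :=
  coset_ZA A Q `&` [set u | relint sigma (map_mx ratr u)].

(* y' is the element attached to y in [-1, 0] /\ D^-1 Z by the multiplier h. *)
Definition is_dwork_prime (D h : nat) (y y' : rat) : Prop :=
  [/\ -1 <= y' <= 0, D%:R * y' \is a Num.int &
      exists2 k : nat, (k < h)%N & h%:R * y - y' = - k%:R].

Definition Eset N (v : 'rV[rat]_N) : set 'rV[int]_N :=
  [set l | forall j, (v 0 j = -1 -> l 0 j <= 0) /\ (v 0 j = 0 -> 0 <= l 0 j)].

(* E(u) for the exponent vector vi = v^(i); the sign conditions are those of v,
   while the equation involves vi. *)
Definition Efiber n N (A : 'M[int]_(N, n)) (v vi : 'rV[rat]_N)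
    (u : 'rV[rat]_n) : set 'rV[int]_N :=
  Eset v `&` [set l | (vi + map_mx intr l) *m map_mx intr A = u].

(* A formal series \sum_e c_e Lambda^e with exponents e in Q^N is identified
   with its coefficient function e |-> c_e. In F_u the sum giving the
   coefficient of Lambda^e has at most one term, the one with l = e - vi. *)
Definition Fseries n N (A : 'M[int]_(N, n)) (v vi : 'rV[rat]_N)
    (u : 'rV[rat]_n) : 'rV[rat]_N -> rat :=
  fun e => \sum_(l \in Efiber A v vi u `&` [set l | vi + map_mx intr l = e])
             mbracket vi l.

Definition p_integral (p : nat) (c : rat) : Prop := ~~ (p %| `|denq c|)%N.

(* Main.v *)
Require Import Defs.
From HB Require Import structures.
From mathcomp Require Import all_boot all_order all_algebra.
From mathcomp Require Import all_classical reals topology normedtype.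
From mathcomp Require Import ring lra zify.

Set Implicit Arguments.
Unset Strict Implicit.
Unset Printing Implicit Defensive.

Import Order.TTheory GRing.Theory Num.Theory.
Import numFieldNormedType.Exports.

Local Open Scope classical_set_scope.
Local Open Scope ring_scope.

(* Dwork's descent.  For p = h mod D, write z = v^(i) and y = v^(i-1), so that
   z = p y + k with digits 0 <= k_j < p.  Dividing l + k by p, with quotient l'
   and remainder r, gives [z]_l = unit * p^(- \sum_j l'_j) * [y]_l' for a p-adic
   unit, as well as y + l' = (z + l) / p - r / p.  Hence the point
   u' = \sum_j (y_j + l'_j) a_j is u / p minus an element of the cone on the
   generators lying on the face - sigma, so u' is again in the relative interior
   of sigma, and the maximality of w(beta^(i-1)) says \sum_j l'_j <= 0.  Thus
   the p-adic valuation can only drop when passing from (z, l) to (y, l'), while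
   the distance of the exponents z_j + l_j to [-1, 0] is divided by p; when that
   distance is 0 one has l = 0 and the coefficient is 1. *)

(** * Rationals integral at [p] and [p]-adic units *)

Lemma p_integral_divz (p : nat) (m d : int) :
  ~~ (p %| `|d|)%N -> p_integral p (m%:~R / d%:~R).
Proof.
rewrite /p_integral; case: divqP => [_|k c k0 /negP pd]; first by rewrite dvdn0.
by apply/negP => pc; apply: pd; rewrite abszM dvdn_mull.
Qed.

(** The units of the localization of the integers at [p]. The fraction need not be reduced, so
    products and inverses require no gcd. *)
Definition p_unit (p : nat) (c : rat) : Prop :=
  exists m d : int,
    [/\ ~~ (p %| `|m|)%N, ~~ (p %| `|d|)%N & c = m%:~R / d%:~R].

Section PUnits.
Variable p : nat.
Hypothesis p_pr : prime p.

Lemma p_unit1 : p_unit p 1.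
Proof.
have p1 : ~~ (p %| 1)%N by rewrite dvdn1; case: eqP p_pr => // ->.
by exists 1, 1; split => //; rewrite divr1.
Qed.

Lemma p_unitM c c' : p_unit p c -> p_unit p c' -> p_unit p (c * c').
Proof.
move=> [m [d [pm pd ->]]] [m' [d' [pm' pd' ->]]].
exists (m * m'), (d * d'); split; rewrite ?abszM ?Euclid_dvdM ?negb_or ?pm ?pd //.
by rewrite !intrM invfM mulrACA.
Qed.

Lemma p_unitV c : p_unit p c -> p_unit p c^-1.
Proof. by move=> [m [d [pm pd ->]]]; exists d, m; rewrite invf_div. Qed.

Lemma p_unitN1X n : p_unit p ((-1) ^+ n).
Proof.
elim: n => [|n IHn]; first exact: p_unit1.
rewrite exprS; apply: p_unitM IHn; case: p_unit1 => m [d [pm pd e]].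
by exists (- m), d; rewrite abszN rmorphN mulNr -e.
Qed.

Lemma p_unit_prod (I : finType) (F : I -> rat) :
  (forall i, p_unit p (F i)) -> p_unit p (\prod_i F i).
Proof. by move=> FU; apply: big_ind => //; [exact: p_unit1|exact: p_unitM]. Qed.

Lemma p_integral_int (m : int) : p_integral p m%:~R.
Proof. by rewrite /p_integral denq_int dvdn1; case: eqP p_pr => // ->. Qed.

Lemma p_unit_integral c c' : p_unit p c -> p_integral p c' -> p_integral p (c * c').
Proof.
move=> [m [d [_ pd ->]]] pc'.
rewrite -[c']divq_num_den mulrACA -invfM -!intrM; apply: p_integral_divz.
by rewrite abszM Euclid_dvdM // negb_or pd.
Qed.

Lemma p_integral_natXM k c : p_integral p c -> p_integral p (p%:R ^+ k * c).
Proof.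
move=> pc; rewrite -[c]divq_num_den mulrA -[p%:R]/(p%:Z%:~R) -rmorphXn -intrM.
exact: p_integral_divz.
Qed.

End PUnits.

(** * Pochhammer products and the descent in one variable *)

Definition pochhammer (z : rat) (m : nat) : rat :=
  \prod_(1 <= k < m.+1) (z + k%:R).

Lemma pochhammer0 z : pochhammer z 0 = 1.
Proof. by rewrite /pochhammer big_geq. Qed.

Lemma pochhammerS z m : pochhammer z m.+1 = pochhammer z m * (z + m.+1%:R).
Proof. by rewrite /pochhammer big_nat_recr. Qed.

Lemma bracket_nat (z : rat) (m : nat) : bracket z m = (pochhammer z m)^-1.
Proof. by []. Qed.

Lemma bracket0 (z : rat) : bracket z 0 = 1.
Proof. by rewrite bracket_nat pochhammer0 invr1. Qed.

(** The reflection [z] to [-1 - z] reduces negative lengths to Pochhammer products. *)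
Lemma bracket_opp (z : rat) (m : nat) :
  bracket z (- m%:Z) = (-1) ^+ m * pochhammer (-1 - z) m.
Proof.
case: m => [|m]; first by rewrite oppr0 bracket0 pochhammer0 expr0 mulr1.
rewrite -NegzE /bracket; elim: m => [|m IHm].
  by rewrite big_nat1 pochhammerS pochhammer0 expr1 mul1r subr0 addrAC addNr add0r mulN1r opprK.
rewrite big_nat_recr //= IHm [in RHS]pochhammerS [in RHS]exprS -!natr1.
by set s := (-1) ^+ m.+1; ring.
Qed.

Section DworkStep.
Variables (p D : nat) (y : rat).
Hypotheses (p_pr : prime p) (pD : coprime p D) (Dy : D%:R * y \is a Num.int).

(** With [t = D y] an integer, the number is [(p t + D k) / D], and [p] divides neither [D] nor
    [D k]. *)
Lemma p_unit_addn (k : nat) : ~~ (p %| k)%N -> p_unit p (p%:R * y + k%:R).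
Proof.
move=> pk; have D0 : D%:R != 0 :> rat.
  rewrite pnatr_eq0; apply: contraTneq pD => ->.
  by rewrite /coprime gcdn0; case: eqP p_pr => // ->.
have pD' : ~~ (p %| D)%N by rewrite -prime_coprime.
have /intrP[t Dyt] := Dy.
exists (p%:Z * t + D%:Z * k%:Z), D%:Z; split => //.
  have pt : (p%:Z %| p%:Z * t + D%:Z * k%:Z)%Z = (p%:Z %| D%:Z * k%:Z)%Z.
    by apply: rpredDl; exact: dvdz_mulr.
  by rewrite dvdzE in pt; rewrite pt dvdzE abszM Euclid_dvdM // negb_or pD' pk.
rewrite rmorphD !rmorphM /= -Dyt -!pmulrn.
by field.
Qed.

(* One factor in p consecutive ones is divisible by p; dividing these by p
   gives the consecutive factors of [pochhammer y]. *)
Lemma pochhammer_dwork (k0 m : nat) : (k0 < p)%N ->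
  exists2 U, p_unit p U &
    pochhammer (p%:R * y + k0%:R) m =
    U * p%:R ^+ ((m + k0) %/ p) * pochhammer y ((m + k0) %/ p).
Proof.
move=> k0p; elim: m => [|m [U uU IHm]].
  exists 1; first exact: p_unit1.
  by rewrite add0n divn_small // !pochhammer0 expr0 !mulr1.
(* The quotient grows by one exactly when [p] divides [(m + k0).+1]; the new factor is then
   [p (y + q + 1)], and otherwise it is a unit. *)
rewrite pochhammerS IHm addSn divnS ?prime_gt0 //.
set q := ((m + k0) %/ p)%N; case: (boolP (p %| (m + k0).+1)%N) => pm.
  exists U => //; rewrite add1n pochhammerS exprS.
  have /eqP : (p * q.+1 = (m + k0).+1)%N.
    by rewrite mulnC -(divnK pm) divnS ?prime_gt0 // pm.
  rewrite -(eqr_nat rat) natrM => /eqP e.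
  have -> : p%:R * y + k0%:R + m.+1%:R = p%:R * (y + q.+1%:R) :> rat.
    by rewrite mulrDr e -addrA -natrD addnC addSn.
  by ring.
exists (U * (p%:R * y + (m + k0).+1%:R)).
  by apply: p_unitM => //; exact: p_unit_addn.
rewrite add0n -[in RHS]addSn [in RHS]addnC natrD; ring.
Qed.

End DworkStep.

(** Positive lengths invert [pochhammer_dwork]; negative ones use it after the reflection, which
    turns [y] into [-1 - y] and the digit [k0] into [p - 1 - k0]. If one bracket has a pole, so does
    the other, and the identity reads [0 = 0]. *)
Lemma bracket_dwork (p D : nat) (y : rat) (k0 : nat) (l : int) :
    prime p -> coprime p D -> D%:R * y \is a Num.int -> (k0 < p)%N ->
  exists l' : int, exists2 r : nat, (r < p)%N & l + k0 = p%:Z * l' + r /\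
    exists2 U, p_unit p U &
      bracket (p%:R * y + k0%:R) l * p%:R ^ l' = U * bracket y l'.
Proof.
move=> p_pr pD Dy k0p.
have p0 : p%:R != 0 :> rat by rewrite pnatr_eq0 -lt0n prime_gt0.
case: (intP l) => [|m|m] {l}.
- exists 0, k0 => //; split; first by rewrite mulr0 !add0r.
  by exists 1; [exact: p_unit1|rewrite !bracket0 !mulr1].
- exists ((m.+1 + k0) %/ p)%N, ((m.+1 + k0) %% p)%N.
    by rewrite ltn_mod prime_gt0.
  split; first by rewrite -PoszM -!PoszD mulnC -divn_eq.
  have [U uU e] := pochhammer_dwork p_pr pD Dy m.+1 k0p.
  exists U^-1; first exact: p_unitV.
  rewrite !bracket_nat e !invfM -exprnP.
  by rewrite mulrAC mulfVK ?expf_neq0.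
- have Dy' : D%:R * (-1 - y) \is a Num.int.
    by rewrite mulrBr mulrN1 rpredB ?rpredN ?rpred_nat.
  have k0p' : (p.-1 - k0 < p)%N by lia.
  have [U uU e] := pochhammer_dwork p_pr pD Dy' m.+1 k0p'.
  set q := ((m.+1 + (p.-1 - k0)) %/ p)%N in e.
  set r := ((m.+1 + (p.-1 - k0)) %% p)%N.
  have rp : (r < p)%N by rewrite ltn_mod prime_gt0.
  have eqr : (m.+1 + (p.-1 - k0) = q * p + r)%N by exact: divn_eq.
  (* Negating [m + 1 + (p - 1 - k0) = q p + r] gives [-(m + 1) + k0 = -q p + (p - 1 - r)]. *)
  exists (- q%:Z), (p.-1 - r)%N; first by lia.
  split; first by nia.
  (* The signs of the two reflections, for [l] and for [l'], go into the unit. *)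
  exists (U * ((-1) ^+ m.+1 * (-1) ^+ q)).
    apply: p_unitM => //; apply: p_unitM => //; exact: p_unitN1X.
  rewrite !bracket_opp.
  have -> : -1 - (p%:R * y + k0%:R) = p%:R * (-1 - y) + (p.-1 - k0)%:R :> rat.
    have -> : (p.-1 - k0)%:R = p%:R - 1 - k0%:R :> rat.
      by rewrite natrB -?subn1 ?natrB //; lia.
    by ring.
  rewrite e -invr_expz -exprnP.
  have s2 : (-1) ^+ q * (-1) ^+ q = 1 :> rat by rewrite -exprMn mulrNN mulr1 expr1n.
  rewrite -/q; set s := (-1) ^+ q in s2 *; set P := pochhammer _ _.
  transitivity ((-1) ^+ m.+1 * U * P); first by field; rewrite expf_neq0.
  by rewrite -[LHS]mulr1 -s2; ring.
Qed.

(** * Relative interiors of cones and faces *)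

Section RelintCone.
Variables (R : realType) (n : nat) (S : set 'rV[R]_n).
Hypothesis S0 : S 0.
Hypothesis S_cone : forall (t : R) x s, 0 < t -> S x -> S s -> S (t *: x + s).

(** The point 0 of [S] carries the missing weight [1 - t - b]. *)
Lemma affine_hull_comb (t b : R) x s :
  affine_hull S x -> S s -> affine_hull S (t *: x + b *: s).
Proof.
move=> [k [c [P [SP c1 ->]]]] Ss.
exists (k + (1 + 1))%N, (row_mx (t *: c) (row_mx b%:M (1 - t - b)%:M)).
exists (col_mx P (col_mx s 0)); split.
- move=> i; rewrite -(splitK i); case: (fintype.split i) => j /=.
    by rewrite rowKu.
  rewrite rowKd -(splitK j); case: (fintype.split j) => j' /=.
    by rewrite rowKu row_id.
  by rewrite rowKd row_id.
- rewrite big_split_ord /=; under eq_bigr do rewrite row_mxEl mxE.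
  under [X in _ + X]eq_bigr do rewrite row_mxEr.
  rewrite -mulr_sumr c1 big_split_ord /= !big_ord1 row_mxEl row_mxEr !mxE /=.
  by ring.
- by rewrite !mul_row_col mulmx0 addr0 mul_scalar_mx -scalemxAl.
Qed.

(** The continuous map [g] sends [t x + s] to [x] and preserves the affine hull, so the
    neighbourhood of [x] pulls back along it. *)
Lemma relint_cone (t : R) x s :
  0 < t -> relint S x -> S s -> relint S (t *: x + s).
Proof.
move=> t0 [Sx nx] Ss; split; first exact: S_cone.
pose g (y : 'rV[R]_n) : 'rV[R]_n := t^-1 *: (y - s).
have tK y : t *: g y + s = y.
  by rewrite /g scalerA divff ?gt_eqF // scale1r subrK.
have cg : g y @[y --> t *: x + s] --> x.
  rewrite -[X in _ --> X](_ : g (t *: x + s) = x); last first.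
    by rewrite /g addrK scalerA mulVf ?gt_eqF // scale1r.
  apply: cvgZl_tmp; first exact: nbhs_filter.
  apply: cvgB; [exact: nbhs_filter|exact: cvg_id|].
  by apply: cvg_cst; exact: nbhs_filter.
apply: (@filterS _ _ (nbhs_filter _) _ _ _ (cg _ nx)) => y /= Sgy Hy.
rewrite -(tK y); apply: S_cone => //.
by apply: Sgy; rewrite /g scalerBr -scaleNr; exact: affine_hull_comb.
Qed.

End RelintCone.

Section Cone.
Variables (R : realType) (n N : nat) (A : 'M[int]_(N, n)).
Local Notation AR := (map_mx intr A : 'M[R]_(N, n)).
Local Notation AQ := (map_mx intr A : 'M[rat]_(N, n)).

Lemma map_ratr_mulA (c : 'rV[rat]_N) :
  map_mx ratr (c *m AQ) = map_mx ratr c *m AR.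
Proof.
rewrite map_mxM -map_mx_comp; congr (_ *m _).
by apply/matrixP => i j; rewrite !mxE /= ratr_int.
Qed.

Lemma linform_mulA (w : 'cV[rat]_n) (c : 'rV[rat]_N) :
    (forall j, linform w (map_mx intr (row j A)) = 1) ->
  linform w (c *m AQ) = \sum_j c 0 j.
Proof.
move=> hw; rewrite /linform -mulmxA mxE; apply: eq_bigr => j _.
transitivity (c 0 j * linform w (map_mx intr (row j A))); last by rewrite hw mulr1.
congr (_ * _); rewrite /linform !mxE.
by apply: eq_bigr => k _; rewrite !mxE.
Qed.

(* The sign conditions force r to be supported on generators lying on the face,
   so that - r *m A is in sigma. *)
Lemma relint_face_shift (sigma : set 'rV[R]_n) (v x : 'rV[rat]_N)
    (r : 'rV[rat]_N) (t : rat) :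
    closed_face [set x | real_cone A (- x)] sigma -> 0 < t ->
    (forall j, v 0 j <= 0) -> sigma (map_mx ratr (v *m AQ)) ->
    (forall j, v 0 j = 0 -> 0 <= x 0 j) ->
    (forall j, 0 <= r 0 j) ->
    (forall j, v 0 j = 0 -> x 0 j = 0 -> r 0 j = 0) ->
    relint sigma (map_mx ratr (x *m AQ)) ->
  relint sigma (map_mx ratr ((t *: x - r) *m AQ)).
Proof.
move=> [f f0 sigmaE] t0 v0 sv x0 r0 rx sx.
have fE (c : 'rV[R]_N) : ((c *m AR) *m f) 0 0 = \sum_j c 0 j * (AR *m f) j 0.
  by rewrite -mulmxA mxE.
have fA j : (AR *m f) j 0 <= 0.
  have /f0 : [set x | real_cone A (- x)] (- (delta_mx 0 j *m AR)).
    by rewrite /= opprK; exists (delta_mx 0 j) => // k; rewrite mxE ler0n.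
  by rewrite mulNmx -mulmxA -rowE !mxE oppr_ge0.
(* [f] vanishes at [v A], and there it is a sum of terms [v_j f(a_j) >= 0]; each of them is
   therefore zero. *)
have vf j : v 0 j != 0 -> (AR *m f) j 0 = 0.
  move: sv; rewrite sigmaE map_ratr_mulA => -[_ /=]; rewrite fE => /eqP.
  rewrite psumr_eq0 => [/allP/(_ j)|k _]; last first.
    by rewrite mulr_le0 // mxE lerq0.
  by rewrite mem_index_enum mxE mulf_eq0 fmorph_eq0 => /(_ isT)/orP[->|/eqP].
(* The same argument at [x A]: terms with [v_k != 0] vanish by [vf], and the others are
   nonpositive. *)
have xf j : v 0 j = 0 -> x 0 j != 0 -> (AR *m f) j 0 = 0.
  move=> vj; have := sx.1; rewrite sigmaE map_ratr_mulA => -[_ /=].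
  rewrite fE => /eqP; rewrite -oppr_eq0 -sumrN psumr_eq0 => [/allP/(_ j)|k _].
    by rewrite mem_index_enum mxE oppr_eq0 mulf_eq0 fmorph_eq0
      => /(_ isT)/orP[->|/eqP].
  rewrite oppr_ge0; have [vk|/vf ->] := eqVneq (v 0 k) 0; last by rewrite mulr0.
  by rewrite mulr_ge0_le0 // mxE ler0q x0.
have rf j : r 0 j = 0 \/ (AR *m f) j 0 = 0.
  have [vj|/vf] := eqVneq (v 0 j) 0; last by right.
  by have [xj|/(xf _ vj)] := eqVneq (x 0 j) 0; [left; exact: rx|right].
have coneC (a : R) y s : 0 < a -> sigma y -> sigma s -> sigma (a *: y + s).
  rewrite sigmaE => a0 [[c c0 /= ey] fy] [[d d0 /= es] fs]; split => /=.
    exists (a *: c + d); first by move=> j; rewrite !mxE addr_ge0 // mulr_ge0 // ltW.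
    by rewrite mulmxDl -scalemxAl -ey -es opprD scalerN.
  by rewrite mulmxDl -scalemxAl mxE fs addr0 mxE fy mulr0.
rewrite mulmxBl -scalemxAl map_mxB map_mxZ.
apply: (relint_cone _ coneC) => //; first 1 last.
- by rewrite ltr0q.
- rewrite sigmaE map_ratr_mulA; split => /=.
    by rewrite opprK; exists (map_mx ratr r) => // j; rewrite mxE ler0q.
  rewrite mulNmx mxE fE big1 ?oppr0 // => j _; rewrite mxE.
  by case: (rf j) => ->; rewrite ?rmorph0 ?mul0r ?mulr0.
- rewrite sigmaE; split => /=; last by rewrite mul0mx mxE.
  by exists 0 => [j|]; rewrite ?mxE // mul0mx oppr0.
Qed.

End Cone.

(** * Digits attached to [p], and integer shifts inside [-1, 0] *)

Section DworkPrime.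
Variables (D h : nat).

Lemma dwork_prime_N1 z : is_dwork_prime D h (-1) z -> z = -1.
Proof.
move=> [/andP[z1 _] _ [k kh e]]; apply/eqP; rewrite eq_le z1 andbT.
have : k%:R + 1 <= h%:R :> rat by rewrite natr1 ler_nat.
by move: e; lra.
Qed.

Lemma dwork_prime_0 z : is_dwork_prime D h 0 z -> z = 0.
Proof.
move=> [/andP[_ z0] _ [k kh e]]; apply/eqP; rewrite eq_le z0 /=.
have : 0 <= k%:R :> rat by [].
by move: e; lra.
Qed.

(** As [p - h] is a multiple of [D] and [D y] is an integer, [z - p y] is an integer. For
    [-1 < y < 0] it lies strictly between -1 and [p]; at the endpoints this bound fails, but there
    [z = y]. *)
Lemma dwork_prime_mod p y z :
    (0 < p)%N -> p = h %[mod D] -> is_dwork_prime D h y z ->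
    -1 <= y <= 0 -> D%:R * y \is a Num.int ->
  exists2 k : nat, (k < p)%N & z = p%:R * y + k%:R.
Proof.
move=> p0 ph dz yb Dy; have [/andP[z1 z0] _ [k kh e]] := dz.
have /intrP[s es] : z - p%:R * y \is a Num.int.
  have -> : z - p%:R * y =
      k%:R + ((h %/ D)%:R - (p %/ D)%:R) * (D%:R * y).
    have hE : h%:R = (h %/ D)%:R * D%:R + (h %% D)%:R :> rat.
      by rewrite -natrM -natrD -divn_eq.
    have pE : p%:R = (p %/ D)%:R * D%:R + (h %% D)%:R :> rat.
      by rewrite -ph -natrM -natrD -divn_eq.
    have -> : z = h%:R * y + k%:R by move: e; lra.
    by rewrite pE hE; ring.
  apply: rpredD; first exact: rpred_nat.
  by apply: rpredM => //; rewrite rpredB ?rpred_nat.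
have p0' : 0 < p%:R :> rat by rewrite ltr0n.
have [s0 sp] : 0 <= s /\ s < p.
  case/andP: yb => y1 y0.
  have [y1E|y1N] := eqVneq y (-1).
    have zE : z = -1 by apply: dwork_prime_N1; rewrite -y1E.
    have : s%:~R = (p%:Z - 1)%:~R :> rat.
      by rewrite -es zE y1E rmorphB /= -pmulrn; lra.
    by move=> /intr_inj ->; lia.
  have [y0E|y0N] := eqVneq y 0.
    have zE : z = 0 by apply: dwork_prime_0; rewrite -y0E.
    have : s%:~R = (0 : int)%:~R :> rat.
      by rewrite -es zE y0E mulr0 subrr.
    by move=> /intr_inj ->; lia.
  have yl : 0 < y + 1 by rewrite -ltrBlDr sub0r lt_neqAle eq_sym y1N.
  have yr : y < 0 by rewrite lt_neqAle y0N.
  have a1 : p%:R * (y + 1) > 0 by rewrite mulr_gt0.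
  have a2 : p%:R * y < 0 by rewrite pmulr_rlt0.
  have b1 : (-1)%:~R < s%:~R :> rat by rewrite -es; lra.
  have b2 : s%:~R < (p%:Z)%:~R :> rat by rewrite -es -pmulrn; lra.
  by move: b1 b2; rewrite !ltr_int; clear; lia.
exists `|s|%N; first by lia.
by rewrite natr_absz ger0_norm // -es; ring.
Qed.

End DworkPrime.

(** A nonzero integer shift within [-1, 0] must exchange the endpoints, which the sign conditions
    forbid. This ends the descent. *)
Lemma int_itvN10 (z : rat) (l : int) : -1 <= z <= 0 -> -1 <= z + l%:~R <= 0 ->
  (z = -1 -> l <= 0) -> (z = 0 -> 0 <= l) -> l = 0.
Proof.
move=> /andP[z1 z0] /andP[l1 l0] zN1 zE0; apply/eqP; rewrite eq_le.
apply/andP; split.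
  have [/zN1//|zN] := eqVneq z (-1).
  have zl : -1 < z by rewrite lt_neqAle eq_sym zN.
  have : l%:~R < 1%:~R :> rat by lra.
  by rewrite ltr_int; lia.
have [/zE0//|zN] := eqVneq z 0.
have zl : z < 0 by rewrite lt_neqAle zN.
have : (-1)%:~R < l%:~R :> rat by lra.
by rewrite ltr_int; lia.
Qed.

(** * The descent in several variables *)

Section MultiBracket.
Variables (N p D : nat) (y z : 'rV[rat]_N).
Hypotheses (p_pr : prime p) (pD : coprime p D).
Hypothesis Dy : forall j, D%:R * y 0 j \is a Num.int.
Hypothesis zE : forall j, exists2 k : nat, (k < p)%N & z 0 j = p%:R * y 0 j + k%:R.

Lemma mbracket_dwork (l : 'rV[int]_N) :
  exists (l' : 'rV[int]_N) (r : 'rV[rat]_N),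
  [/\ forall j, exists2 k : nat, (k < p)%N & r 0 j = k%:R,
      z + map_mx intr l = p%:R *: (y + map_mx intr l') + r &
      exists2 U, p_unit p U &
      mbracket z l * p%:R ^ (\sum_j l' 0 j) = U * mbracket y l'].
Proof.
have p0 : p%:R != 0 :> rat by rewrite pnatr_eq0 -lt0n prime_gt0.
pose P j (t : int * nat * rat) := [/\ (t.1.2 < p)%N,
  z 0 j + (l 0 j)%:~R = p%:R * (y 0 j + t.1.1%:~R) + t.1.2%:R, p_unit p t.2 &
  bracket (z 0 j) (l 0 j) * p%:R ^ t.1.1 = t.2 * bracket (y 0 j) t.1.1].
have /fin_all_exists[t tP] : forall j, exists t, P j t.
  move=> j; have [k kp zj] := zE j.
  have [l' [r rp [e [U uU eU]]]] := bracket_dwork (l 0 j) p_pr pD (Dy j) kp.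
  exists (l', r, U); split => //=; last by rewrite zj.
  have : (l 0 j)%:~R + k%:R = p%:R * l'%:~R + r%:R :> rat.
    by move: e => /(congr1 (intr : int -> rat)); rewrite !rmorphD rmorphM /= -!pmulrn.
  by rewrite zj mulrDr; lra.
exists (\row_j (t j).1.1), (\row_j (t j).1.2%:R); split.
- by move=> j; have [tp _ _ _] := tP j; exists (t j).1.2; rewrite ?mxE.
- by apply/rowP => j; have [_ e _ _] := tP j; rewrite !mxE.
- exists (\prod_j (t j).2); first by apply: p_unit_prod => // j; case: (tP j).
  under [X in _ ^ X]eq_bigr do rewrite mxE.
  rewrite (big_morph (fun m : int => p%:R ^ m) (fun m k => expfzDr m k p0) (expr0z _)).
  rewrite /mbracket -!big_split; apply: eq_bigr => j _.
  by have [_ _ _ e] := tP j; rewrite mxE.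
Qed.

End MultiBracket.

(** * Descent along the cycle of the vectors [vs i] *)

Theorem theorem2p21 (R : realType) (n N : nat) (A : 'M[int]_(N, n))
    (w : 'cV[rat]_n)
    (hw : forall j, linform w (map_mx intr (row j A)) = 1)
    (Q : 'rV[rat]_n) (hQ : (Q <= (map_mx intr A : 'M[rat]_(N, n)))%MS)
    (sigma : set 'rV[R]_n)
    (hsigma : closed_face [set x | real_cone A (- x)] sigma)
    (hM : coset_relint A sigma Q !=set0)
    (beta : 'rV[rat]_n)
    (hbeta : coset_relint A sigma Q beta)
    (hbeta_max : is_max (linform w @` coset_relint A sigma Q) (linform w beta))
    (v : 'rV[rat]_N) (hv : forall j, v 0 j <= 0)
    (hv_beta : beta = v *m map_mx intr A)
    (D h a : nat) (hD : (0 < D)%N) (hDv : forall j, D%:R * v 0 j \is a Num.int)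
    (hh : (0 < h)%N) (hhD : coprime h D)
    (vs : nat -> 'rV[rat]_N)
    (hvs0 : vs 0%N = v)
    (hvsS : forall i j, is_dwork_prime D h (vs i 0 j) (vs i.+1 0 j))
    (ha : (0 < a)%N) (hvsa : vs a = v)
    (hmax : forall i, (i < a)%N ->
       is_max (linform w @` coset_relint A sigma (h%:R ^+ i *: Q))
              (linform w (vs i *m map_mx intr A))) :
  forall i, (i < a)%N ->
  forall u : 'rV[rat]_n, coset_relint A sigma (h%:R ^+ i *: Q) u ->
  forall p : nat, prime p -> p = h %[mod D] ->
  forall e : 'rV[rat]_N, p_integral p (Fseries A v (vs i) u e).
Proof.
have vsb i j : -1 <= vs i 0 j <= 0.
  case: i => [|i]; last by case: (hvsS i j).
  by rewrite hvs0 -hvsa -(prednK ha); case: (hvsS a.-1 j).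
have vsD i j : D%:R * vs i 0 j \is a Num.int.
  by case: i => [|i]; [rewrite hvs0|case: (hvsS i j)].
have vs_add1 i k j : vs i 0 j = -1 -> vs (i + k)%N 0 j = -1.
  move=> e; elim: k => [|k IHk]; first by rewrite addn0.
  by have := hvsS (i + k)%N j; rewrite IHk addnS; exact: dwork_prime_N1.
have vs_add0 i k j : vs i 0 j = 0 -> vs (i + k)%N 0 j = 0.
  move=> e; elim: k => [|k IHk]; first by rewrite addn0.
  by have := hvsS (i + k)%N j; rewrite IHk addnS; exact: dwork_prime_0.
have vsN1 i j : v 0 j = -1 -> vs i 0 j = -1.
  by rewrite -hvs0 => /(vs_add1 _ i); rewrite add0n.
have vs0 i j : v 0 j = 0 -> vs i 0 j = 0.
  by rewrite -hvs0 => /(vs_add0 _ i); rewrite add0n.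
(* Going round the cycle up to [vs a = v] carries the values -1 and 0 back to [v], whose entries
   define [Eset]. *)
have vN1 i j : (i < a)%N -> vs i 0 j = -1 -> v 0 j = -1.
  by move=> ia /(vs_add1 _ (a - i)%N); rewrite subnKC ?hvsa // ltnW.
have v0 i j : (i < a)%N -> vs i 0 j = 0 -> v 0 j = 0.
  by move=> ia /(vs_add0 _ (a - i)%N); rewrite subnKC ?hvsa // ltnW.
have vsZ i : coset_ZA A (h%:R ^+ i *: Q) (vs i *m map_mx intr A).
  elim: i => [|i [m em]].
    by rewrite expr0 scale1r hvs0 -hv_beta; exact: hbeta.1.
  have /fin_all_exists[c cE] : forall j, exists c : int,
      vs i.+1 0 j = h%:R * vs i 0 j + c%:~R.
    move=> j; have [_ _ [k _ e]] := hvsS i j; exists k%:Z.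
    by rewrite -pmulrn; lra.
  exists (h%:Z *: m + \row_j c j).
  have -> : vs i.+1 = h%:R *: vs i + map_mx intr (\row_j c j).
    by apply/rowP => j; rewrite !mxE cE.
  rewrite mulmxDl -scalemxAl em scalerDr scalerA -exprS mulmxDl -scalemxAl.
  by rewrite map_mxD map_mxZ -addrA -!map_mxM.
(* The descent runs backwards along the cycle, so 0 is preceded by [a - 1]. *)
pose prev i := if i is i'.+1 then i' else a.-1.
have prev_lt i : (i < a)%N -> (prev i < a)%N.
  by case: i => [_|i /ltnW//] /=; rewrite prednK.
have prevP i j : is_dwork_prime D h (vs (prev i) 0 j) (vs i 0 j).
  case: i => [|i] //=.
  by rewrite hvs0 -hvsa -[in X in _ _ X](prednK ha).
move=> i0 i0a u [_ su] p p_pr ph e.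
have pD : coprime p D by rewrite -coprime_modl ph coprime_modl.
have p_gt0 := prime_gt0 p_pr.
have pR0 : 0 < p%:R :> rat by rewrite ltr0n.
have DR0 : 0 < D%:R :> rat by rewrite ltr0n.
(* The bound p^k controls D times the distance of vs i + l to [-1, 0]. *)
have key k : forall i l, (i < a)%N -> Eset v l ->
    relint sigma (map_mx ratr ((vs i + map_mx intr l) *m map_mx intr A)) ->
    (forall j, D%:R * (vs i 0 j + (l 0 j)%:~R) < p%:R ^+ k /\
               D%:R * (-1 - (vs i 0 j + (l 0 j)%:~R)) < p%:R ^+ k) ->
    p_integral p (mbracket (vs i) l).
  elim: k => [|k IHk] i l ia El sl lk.
    (* The integer [D (z_j + l_j)] is less than 1 and greater than [-D - 1], so [z_j + l_j] lies in
       [-1, 0]. *)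
    have -> : l = 0.
      apply/rowP => j; rewrite mxE.
      have /intrP[s es] : D%:R * (vs i 0 j + (l 0 j)%:~R) \is a Num.int.
        by rewrite mulrDr rpredD // rpredM ?rpred_nat ?rpred_int.
      have [lk1 lk2] := lk j; rewrite mulrBr es expr0 in lk1 lk2.
      have s0 : s%:~R <= 0 :> rat by move: lk1; rewrite ltrz1 lerz0; lia.
      have s1 : - D%:R <= s%:~R :> rat.
        have : (- D%:Z - 1)%:~R < s%:~R :> rat.
          by rewrite rmorphB rmorphN /= -!pmulrn; lra.
        rewrite ltr_int => ?.
        have : (- D%:Z)%:~R <= s%:~R :> rat by rewrite ler_int; lia.
        by rewrite rmorphN.
      apply: (int_itvN10 (vsb i j)).
      - apply/andP; split; last by rewrite -(pmulr_rle0 _ DR0) es.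
        by rewrite -(ler_pM2l DR0) es; lra.
      - by move=> /(vN1 _ _ ia); exact: (El j).1.
      - by move=> /(v0 _ _ ia); exact: (El j).2.
    rewrite /mbracket big1 => [|j _]; last by rewrite mxE bracket0.
    exact: (p_integral_int p_pr 1).
  set z := vs i in sl lk *; set y := vs (prev i).
  have zE j : exists2 k0 : nat, (k0 < p)%N & z 0 j = p%:R * y 0 j + k0%:R.
    exact: (dwork_prime_mod p_gt0 ph (prevP i j) (vsb _ _) (vsD _ _)).
  have [l' [r [rE xE [U uU eU]]]] := mbracket_dwork p_pr pD (vsD (prev i)) zE l.
  have xEj j : z 0 j + (l 0 j)%:~R = p%:R * (y 0 j + (l' 0 j)%:~R) + r 0 j.
    by move/rowP/(_ j): xE; rewrite !mxE.
  have r0 j : 0 <= r 0 j by have [k0 _ ->] := rE j.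
  have x0E j : v 0 j = 0 -> exists2 k0 : nat, (k0 < p)%N &
      l 0 j = p%:Z * l' 0 j + k0 /\ r 0 j = k0%:R.
    move=> vj; have [k0 k0p rk] := rE j; exists k0 => //; split=> //.
    apply: (@intr_inj rat); move: (xEj j); rewrite /z /y !vs0 // !add0r => ->.
    by rewrite rmorphD rmorphM /= rk.
  have El' : Eset v l'.
    move=> j; split => vj; last first.
      by have [k0 k0p [el _]] := x0E j vj; have := (El j).2 vj; nia.
    have [k0 k0p rk] := rE j; have := (El j).1 vj.
    have : -1 + l 0 j = p%:Z * (-1 + l' 0 j) + k0.
      apply: (@intr_inj rat); move: (xEj j); rewrite /z /y !vsN1 // rk.
      by rewrite !rmorphD rmorphM /= rmorphD.
    by nia.
  have x'E : y + map_mx intr l' = p%:R^-1 *: (z + map_mx intr l) - p%:R^-1 *: r.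
    by rewrite xE scalerDr addrK scalerA mulVf ?scale1r // gt_eqF.
  have sl' : relint sigma
      (map_mx ratr ((y + map_mx intr l') *m map_mx intr A)).
    rewrite x'E; apply: (relint_face_shift hsigma (v := v)) => //.
    - by rewrite invr_gt0.
    - by rewrite -hv_beta; exact: hbeta.2.1.
    - move=> j vj; rewrite !mxE /z vs0 // add0r ler0z; exact: (El j).2.
    - by move=> j; rewrite mxE mulr_ge0 // invr_ge0 ltW.
    (* If [l_j = 0], then [p l'_j = - k0] with [0 <= k0 < p] forces [k0 = 0]. *)
    - move=> j vj; have [k0 k0p [el rk]] := x0E j vj.
      rewrite !mxE /z vs0 // add0r => /eqP; rewrite intr_eq0 => /eqP l0.
      have -> : r 0 j = 0.
        have k00 : k0 = 0%N.
          move: el; rewrite l0.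
          by have [?|?] : 0 <= l' 0 j \/ l' 0 j <= -1; [lia|nia|nia].
        by rewrite rk k00.
      by rewrite mulr0.
  (* By [hw], [w] takes the value [\sum_j y_j + \sum_j l'_j] at the new point, and its maximum is
     [\sum_j y_j]. *)
  have l'_le0 : \sum_j l' 0 j <= 0.
    have [_ ub] := hmax _ (prev_lt _ ia).
    have /ub : (linform w @` coset_relint A sigma (h%:R ^+ prev i *: Q))
        (linform w ((y + map_mx intr l') *m map_mx intr A)).
      apply: imageP; split => //; have [m em] := vsZ (prev i).
      by exists (m + l'); rewrite mulmxDl em -addrA -map_mxM -map_mxD -mulmxDl.
    rewrite !linform_mulA //; under eq_bigr do rewrite !mxE.
    by rewrite big_split /= gerDl -rmorph_sum /= lerz0.
  (* Multiplied by [p], the upper excess decreases because [r_j >= 0], and the lower one does not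
     increase because [r_j <= p - 1]. *)
  have /(IHk _ _ (prev_lt _ ia) El' sl') ily : forall j,
      D%:R * (y 0 j + (l' 0 j)%:~R) < p%:R ^+ k /\
      D%:R * (-1 - (y 0 j + (l' 0 j)%:~R)) < p%:R ^+ k.
    move=> j; have [lk1 lk2] := lk j.
    have [k0 k0p rk] := rE j.
    have r1 : r 0 j <= p%:R - 1.
      by rewrite rk lerBrDr natr1 ler_nat.
    rewrite !exprS (xEj j) in lk1 lk2.
    have Dr : 0 <= D%:R * r 0 j by rewrite mulr_ge0 // ltW.
    have Dr' : D%:R * r 0 j <= D%:R * (p%:R - 1) by rewrite ler_pM2l.
    by split; rewrite -(ltr_pM2l pR0); [move: lk1|move: lk2]; lra.
  have -> : mbracket z l = p%:R ^+ `|\sum_j l' 0 j| * (U * mbracket y l').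
    have pn0 : p%:R != 0 :> rat by rewrite gt_eqF.
    rewrite -eU mulrCA exprnP -expfzDr // abszE ler0_norm // addNr.
    by rewrite expr0z mulr1.
  by apply: p_integral_natXM => //; exact: p_unit_integral.
rewrite /Fseries; set S := _ `&` _.
have [S0|/set0P[l [[El lu] le]]] := eqVneq S set0.
  by rewrite S0 fsbig_set0; exact: (p_integral_int p_pr 0).
have -> : S = [set l].
  apply/seteqP; split => [l'|_ ->] //= [_ /= le']; apply/rowP => j.
  by move: le'; rewrite -le => /addrI/rowP/(_ j); rewrite !mxE => /intr_inj.
rewrite fsbig_set1.
(* Some power of [p] exceeds the sum [B] of bounds for all coordinates, which starts the
   induction. *)
have [k kP] : exists k : nat, forall j,
    D%:R * (vs i0 0 j + (l 0 j)%:~R) < p%:R ^+ k /\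
    D%:R * (-1 - (vs i0 0 j + (l 0 j)%:~R)) < p%:R ^+ k.
  pose B : rat := \sum_j D%:R * (1 + `|vs i0 0 j + (l 0 j)%:~R|).
  have [k Bk] : exists k : nat, B < p%:R ^+ k.
    have B0 : 0 <= B.
      by apply: sumr_ge0 => j _; rewrite mulr_ge0 ?addr_ge0 // ltW.
    exists (Num.bound B); apply: (lt_trans (archi_boundP B0)).
    by rewrite -natrX ltr_nat ltn_expl // prime_gt1.
  exists k => j.
  have Bj : D%:R * (1 + `|vs i0 0 j + (l 0 j)%:~R|) <= B.
    rewrite /B (bigD1 j) //= lerDl sumr_ge0 // => j' _.
    by rewrite mulr_ge0 ?addr_ge0 // ltW.
  split; apply: le_lt_trans Bk; apply: le_trans Bj; rewrite ler_pM2l //.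
    by rewrite (le_trans (ler_norm _)) // lerDr.
  by have := ler_norm (- (vs i0 0 j + (l 0 j)%:~R)); rewrite normrN; lra.
by apply: (key k) => //; rewrite lu.
Qed.
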